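(* Let $X$ be a nonempty bounded subset of a normed space $E$, let $F$ be a real Banach space, and let $(n_k)_{k\in\mathbb N}$ be a sequence of positive integers. For each $k\in\mathbb N$ let $l_{1,k},\dots,l_{n_k,k}:X\to X$ be injective contractions with $l_{i,k}(X)\cap l_{j,k}(X)=\emptyset$ for $i\ne j$ and $X=\bigcup_{i=1}^{n_k}l_{i,k}(X)$. Let $q_{i,k}\in\mathcal B(X,F)$ and $s_{i,k}\in\mathcal B(X,\mathbb R)$ ($k\in\mathbb N$, $1\le i\le n_k$) satisfy $$s:=\sup_{k\in\mathbb N}\max_{1\le i\le n_k}\|s_{i,k}\|_\infty<1,\qquad \sup_{k\in\mathbb N}\max_{1\le i\le n_k}\|q_{i,k}\|\le M$$ for some $M>0$, and let $T_k:\mathcal B(X,F)\to\mathcal B(X,F)$ be defined by $$(T_kf)(l_{i,k}(x)):=q_{i,k}(x)+s_{i,k}(x)\cdot f(x),\qquad x\in X,\ 1\le i\le n_k.$$ Let $\mathscr I$ be the closed ball in $\mathcal B(X,F)$ of radius $M/(1-s)$ centered at $0$. Then the backward trajectories $$\Psi_k(f_0):=T_1\circ T_2\circ\cdots\circ T_k(f_0),\qquad k\in\mathbb N,$$ converge as $k\to\infty$, for any initial $f_0\in\mathscr I$, to a unique function $\psi\in\mathscr I$ (the same for all $f_0\in\mathscr I$).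
   Context: $\mathcal B(X,F)$ is the Banach space of bounded functions $X\to F$ with the supremum norm $\|f\|=\sup_{x\in X}\|f(x)\|_F$, and convergence is in this norm; $\|s\|_\infty=\sup_{x\in X}|s(x)|$ for $s\in\mathcal B(X,\mathbb R)$. A contraction is a map with Lipschitz constant $<1$. *)

(* Defs.v *)
From HB Require Import structures.
From mathcomp Require Import all_boot all_order all_algebra.
From mathcomp Require Import all_classical all_reals all_analysis.

Set Implicit Arguments.
Unset Strict Implicit.
Unset Printing Implicit Defensive.

Import Order.TTheory GRing.Theory Num.Theory.
Import numFieldNormedType.Exports.

Local Open Scope classical_set_scope.
Local Open Scope ring_scope.

Section BoundedFunctions.
Context {R : realType} (T : Type) (F : normedModType R).

Definition is_bounded_fun : {pred T -> F} :=
  [pred f : T -> F | `[< bounded_fun f >]].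

Record bfun := BFun { bfun_val :> T -> F; bfunP : bfun_val \in is_bounded_fun }.

HB.instance Definition _ := [isSub for bfun_val].
HB.instance Definition _ := [Choice of bfun by <:].

Lemma is_bounded_funP (f : T -> F) :
  reflect (exists M, forall x, `|f x| <= M) (f \in is_bounded_fun).
Proof.
apply: (iffP (asboolP (bounded_fun f))).
  by case=> M [_ fM]; exists (M + 1) => x; apply: fM => //; rewrite ltrDl.
move=> [M fM]; exists M; split; first exact: num_real.
by move=> N /ltW MN x _; exact: le_trans (fM x) MN.
Qed.

Lemma is_bounded_fun_submod_closed : submod_closed is_bounded_fun.
Proof.
split; first by apply/is_bounded_funP; exists 0 => x; rewrite normr0.
move=> a f g /is_bounded_funP[M fM] /is_bounded_funP[N gN].
apply/is_bounded_funP; exists (`|a| * M + N) => x.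
rewrite (le_trans (ler_normD _ _))// lerD// normrZ.
exact: ler_wpM2l.
Qed.

HB.instance Definition _ := GRing.isSubmodClosed.Build _ _ is_bounded_fun
  is_bounded_fun_submod_closed.
HB.instance Definition _ := [SubChoice_isSubLmodule of bfun by <:].

(* When [T] is empty the set below is empty and [sup set0 = 0], which is the
   norm of the only function. *)
Definition supnorm (f : bfun) : R := sup (range (fun x => `|f x|)).

Lemma le_supnorm (f : bfun) x : `|f x| <= supnorm f.
Proof.
apply: ub_le_sup; last by exists x.
by have /is_bounded_funP[M fM] := bfunP f; exists M => _ [y _ <-].
Qed.

Lemma supnorm_le (f : bfun) (M : R) :
  0 <= M -> (forall x, `|f x| <= M) -> supnorm f <= M.
Proof.
move=> M0 fM; rewrite /supnorm.
have [r0|r0] := pselect (range (fun x => `|f x|) !=set0).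
  by apply: ge_sup => // _ [x _ <-].
by rewrite sup_out// => -[].
Qed.

Lemma supnorm_ge0 (f : bfun) : 0 <= supnorm f.
Proof.
have [[_ [x _ _]]|r0] := pselect (range (fun x => `|f x|) !=set0).
  exact: le_trans (le_supnorm f x).
by rewrite /supnorm sup_out// => -[].
Qed.

Lemma supnormD (f g : bfun) : supnorm (f + g) <= supnorm f + supnorm g.
Proof.
apply: supnorm_le => [|x]; first by rewrite addr_ge0 ?supnorm_ge0.
by rewrite (le_trans (ler_normD _ _))// lerD ?le_supnorm.
Qed.

Lemma supnormZ (a : R) (f : bfun) : supnorm (a *: f) = `|a| * supnorm f.
Proof.
have le b (g : bfun) : supnorm (b *: g) <= `|b| * supnorm g.
  apply: supnorm_le => [|x]; first by rewrite mulr_ge0 ?supnorm_ge0.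
  by rewrite normrZ ler_wpM2l ?le_supnorm.
apply/eqP; rewrite eq_le le/=.
have [->|a0] := eqVneq a 0; first by rewrite normr0 mul0r supnorm_ge0.
rewrite -ler_pdivlMl ?normr_gt0// -normfV.
by rewrite -[in leLHS](scalerK a0 f) le.
Qed.

Lemma supnorm0_eq0 (f : bfun) : supnorm f = 0 -> f = 0.
Proof.
move=> f0; apply/val_inj/funext => x; apply/normr0_eq0/le_anti.
by rewrite normr_ge0 -f0 le_supnorm.
Qed.

HB.instance Definition _ :=
  Lmodule_isNormed.Build R bfun supnormD supnormZ supnorm0_eq0.

Lemma bfun_normE (f : bfun) : `|f| = sup (range (fun x => `|f x|)).
Proof. by []. Qed.

End BoundedFunctions.

Notation "''B' ( T , F )" := (bfun T F) (format "''B' ( T ,  F )").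

Section Complete.
Context {R : realType} (T : Type) (F : completeNormedModType R).

Lemma bfun_complete (G : set_system 'B(T, F)) :
  ProperFilter G -> cauchy G -> cvg G.
Proof.
move=> PG /cauchyP cG.
have evG x : cvg ((fun f : 'B(T, F) => f x) @ G).
  apply/cauchy_cvgP/cauchy_exP => e e0.
  have [f0 Gf0] := cG _ e0; exists (f0 x); rewrite /=.
  apply: filterS Gf0 => h; rewrite -!ball_normE/=; apply: le_lt_trans.
  exact: (le_supnorm (f0 - h)).
pose g x : F := lim ((fun f : 'B(T, F) => f x) @ G).
have near_g f0 (e : R) : G (ball f0 e) -> forall x, `|f0 x - g x| <= e.
  move=> Gf0 x; apply/ler_addgt0Pr => d d0.
  have /cvgrPdist_lt/(_ _ d0) Gg := evG x.
  have [h []] := filter_ex (filterI Gf0 Gg).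
  rewrite -ball_normE/= => f0h gh.
  rewrite (le_trans (ler_distD (h x) _ _))// lerD//; last first.
    by rewrite distrC ltW.
  exact: le_trans (le_supnorm (f0 - h) x) (ltW f0h).
have gb : g \in @is_bounded_fun R T F.
  have [f0 /near_g f0g] := cG _ ltr01.
  apply/is_bounded_funP; exists (`|f0| + 1) => x.
  rewrite -[g x](subKr (f0 x)) (le_trans (ler_normB _ _))// lerD//.
  exact: le_supnorm.
apply/cvg_ex; exists (BFun gb); apply/cvgrPdist_le => e e0.
have [f0 Gf0] := cG _ (divr_gt0 e0 (ltr0n _ 2)).
have f0g := near_g _ _ Gf0.
apply: filterS Gf0 => h; rewrite -ball_normE/= => f0h.
rewrite [e]splitr (le_trans (ler_distD f0 _ _))// lerD//; last exact: ltW.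
rewrite distrC; apply: supnorm_le; first by rewrite divr_ge0 ?ltW.
exact: f0g.
Qed.

HB.instance Definition _ := Uniform_isComplete.Build 'B(T, F) bfun_complete.

End Complete.

(* Maps into [X] are functions on the subtype [set_type X], so that [l x] is a
   point of [X]; distances are those of the ambient space [E]. *)
Definition set_contraction {R : realType} {E : normedModType R} (X : set E)
    (l : X -> X) : Prop :=
  exists2 c : R, 0 <= c < 1 &
    forall x y : X,
      `|set_val (l x) - set_val (l y)| <= c * `|set_val x - set_val y|.

(* [backward T k = T 0 \o T 1 \o ... \o T k.-1], i.e. the composition of the
   first [k] operators of the sequence, which is indexed from 0. *)
Fixpoint backward {B : Type} (T : nat -> B -> B) (k : nat) : B -> B :=
  if k is k'.+1 then backward T k' \o T k' else id.

(* Main.v *)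
Require Import Defs.
From HB Require Import structures.
From mathcomp Require Import all_boot all_order all_algebra.
From mathcomp Require Import all_classical all_reals all_analysis.
From mathcomp Require Import ring.

Set Implicit Arguments.
Unset Strict Implicit.
Unset Printing Implicit Defensive.

Import Order.TTheory GRing.Theory Num.Theory.
Import numFieldNormedType.Exports.

Local Open Scope classical_set_scope.
Local Open Scope ring_scope.

(** Each operator [T k] contracts the supremum norm by the same factor [sbar < 1]
    (lemma [weighted_pullback_dist]) and maps the closed ball of radius
    [M / (1 - sbar)] into itself, because that radius [r] is the solution of
    [M + sbar * r = r]; both facts hold because every point of [X] is some
    [l k i x], where the value of [T k f] is explicit. The composition of the
    first [k] operators therefore shrinks distances by [sbar ^+ k].

    In a backward trajectory the new operator is inserted innermost, so for
    [K <= k] the [k]-th term is the image, under the composition of the first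
    [K] operators, of some other point of the ball
    ([backward_invariant_factor]). Hence all terms from rank [K] on lie within
    [sbar ^+ K] times the diameter of the ball of one another: the trajectory is
    Cauchy although the operators vary with [k]. The same estimate applied to two
    starting points shows that the limit does not depend on the starting point
    ([backward_cvg]). *)

Lemma backward_stable (B : Type) (D : set B) (T : nat -> B -> B) k f :
  (forall k f, D f -> D (T k f)) -> D f -> D (backward T k f).
Proof. by move=> TD; elim: k f => //= k IHk f Df; exact/IHk/TD. Qed.

(** The operators of index at least [K] act first and stay in the invariant set,
    so the tail of a backward trajectory is contained in the image of that set
    under the composition of the first [K] operators. *)
Lemma backward_invariant_factor (B : Type) (D : set B) (T : nat -> B -> B)
    K k f :
  (forall k f, D f -> D (T k f)) -> D f -> (K <= k)%N ->
  exists2 g, D g & backward T k f = backward T K g.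
Proof.
move=> TD Df /subnKC <-; elim: (k - K)%N f Df => [|m IHm] f Df.
  by rewrite addn0; exists f.
by rewrite addnS /=; exact/IHm/TD.
Qed.

Lemma backward_dist (R : numDomainType) (V : normedZmodType R)
    (T : nat -> V -> V) (c : R) k f g :
  0 <= c -> (forall k f g, `|T k f - T k g| <= c * `|f - g|) ->
  `|backward T k f - backward T k g| <= c ^+ k * `|f - g|.
Proof.
move=> c0 Tc; elim: k f g => [|k IHk] f g /=; first by rewrite mul1r.
rewrite (le_trans (IHk _ _))// exprSr -mulrA.
by rewrite ler_wpM2l ?exprn_ge0.
Qed.

(** Variable-operator version of the Banach fixed point theorem. The role of
    the fixed point equation is taken by the nesting of the tails: after rank
    [K] all terms lie in one set of diameter at most [c ^+ K * d]. *)
Lemma backward_cvg (R : realType) (V : completeNormedModType R) (D : set V)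
    (d : R) (T : nat -> V -> V) (c : R) :
  D !=set0 -> closed D -> (forall f g, D f -> D g -> `|f - g| <= d) ->
  0 <= c < 1 -> (forall k f, D f -> D (T k f)) ->
  (forall k f g, `|T k f - T k g| <= c * `|f - g|) ->
  exists2 psi, D psi &
    forall f, D f -> backward T k f @[k --> \oo] --> psi.
Proof.
move=> [f0 Df0] clD Dd /andP[c0 c1] TD Tc.
have dist_le k f g : D f -> D g ->
    `|backward T k f - backward T k g| <= c ^+ k * d.
  move=> Df Dg; apply: le_trans (backward_dist _ _ _ c0 Tc) _.
  by rewrite ler_wpM2l ?exprn_ge0 ?Dd.
have cvg_cd : (c ^+ k * d) @[k --> \oo] --> (0 : R).
  rewrite -[X in _ --> X](mul0r d); apply: cvgMr_tmp.
  by apply: cvg_expr; rewrite ger0_norm.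
have small e : 0 < e -> \forall k \near \oo, c ^+ k * d < e.
  by move=> e0; exact: (cvgr_lt (0 : R) cvg_cd e e0).
have : cvg (backward T k f0 @[k --> \oo]).
  apply/cauchy_cvgP/cauchy_exP => e /small[K _ Kd].
  exists (backward T K f0); exists K => // k /= Kk.
  have [g Dg ->] := backward_invariant_factor TD Df0 Kk.
  rewrite -ball_normE /=.
  exact: le_lt_trans (dist_le _ _ _ Df0 Dg) (Kd K (leqnn K)).
move=> /cvg_ex[psi psiP]; exists psi.
  have D_near : \forall k \near \oo, D (backward T k f0).
    by near=> k; exact: backward_stable.
  exact: (@closed_cvg _ _ _ eventually_filter _ D clD D_near psi psiP).
move=> f Df; apply/cvgrPdist_lt => e e0.
have e2 : 0 < e / 2 by rewrite divr_gt0.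
have /cvgrPdist_lt/(_ _ e2) psi_near := psiP.
near=> k.
rewrite [e]splitr (le_lt_trans (ler_distD (backward T k f0) _ _))// ltrD//.
  by near: k.
by apply: le_lt_trans (dist_le _ _ _ Df0 Df) _; near: k; exact: small.
Unshelve. all: by end_near. Qed.

Lemma le_ereal_sup_bigmax (R : realType) (n : nat -> nat)
    (a : forall k, 'I_(n k) -> R) (b : R) :
  (ereal_sup (range (fun k => (\big[Num.max/0]_(i < n k) a k i)%:E))
    <= b%:E)%E ->
  forall k i, a k i <= b.
Proof.
move=> ab k i; rewrite -lee_fin; apply: le_trans ab.
apply: le_trans (ereal_sup_ubound _); last by exists k.
by rewrite lee_fin le_bigmax.
Qed.

Section WeightedPullback.
Context {R : realType} {X I : Type} {F : normedModType R}.
Variables (l : I -> X -> X) (q : I -> 'B(X, F)) (s : I -> 'B(X, R^o)).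
Variables (U : 'B(X, F) -> 'B(X, F)) (c : R).
Hypothesis l_cover : forall y, exists i x, y = l i x.
Hypothesis U_def : forall f i x, U f (l i x) = q i x + s i x *: f x.
Hypotheses (c_ge0 : 0 <= c) (s_le : forall i, `|s i| <= c).

Let scale_le i x (f : 'B(X, F)) : `|s i x *: f x| <= c * `|f|.
Proof.
rewrite normrZ ler_pM ?le_supnorm//.
exact: le_trans (le_supnorm (s i) x) (s_le i).
Qed.

Lemma weighted_pullback_dist f g : `|U f - U g| <= c * `|f - g|.
Proof.
apply: supnorm_le => [|y]; first by rewrite mulr_ge0.
have [i [x ->]] := l_cover y.
have -> : (U f - U g) (l i x) = s i x *: (f - g) x.
  transitivity (U f (l i x) - U g (l i x)); first by [].
  by rewrite !U_def opprD addrACA subrr add0r -scalerBr.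
exact: scale_le.
Qed.

Lemma weighted_pullback_norm (M : R) f :
  0 <= M -> (forall i, `|q i| <= M) -> `|U f| <= M + c * `|f|.
Proof.
move=> M0 qM; apply: supnorm_le => [|y]; first by rewrite addr_ge0 ?mulr_ge0.
have [i [x ->]] := l_cover y.
rewrite U_def (le_trans (ler_normD _ _))// lerD//.
exact: le_trans (le_supnorm (q i) x) (qM i).
Qed.

End WeightedPullback.

Theorem theorem4p2 (R : realType) (E : normedModType R)
  (F : completeNormedModType R) (X : set E)
  (X_neq0 : X !=set0) (X_bounded : bounded_set X)
  (n : nat -> nat) (n_gt0 : forall k, (0 < n k)%N)
  (l : forall k, 'I_(n k) -> X -> X)
  (l_inj : forall k i, injective (l k i))
  (l_contr : forall k i, set_contraction (l k i))
  (l_disj : forall k i j, i != j -> range (l k i) `&` range (l k j) = set0)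
  (l_cover : forall k, [set: X] = \bigcup_(i : 'I_(n k)) range (l k i))
  (q : forall k, 'I_(n k) -> 'B(X, F))
  (s : forall k, 'I_(n k) -> 'B(X, R^o))
  (sbar : R)
  (s_sup : ereal_sup (range (fun k => (\big[Num.max/0]_(i < n k) `|s k i|)%:E))
           = sbar%:E)
  (sbar_lt1 : sbar < 1)
  (M : R) (M_gt0 : 0 < M)
  (q_sup : (ereal_sup (range (fun k => (\big[Num.max/0]_(i < n k) `|q k i|)%:E))
            <= M%:E)%E)
  (T : nat -> 'B(X, F) -> 'B(X, F))
  (T_def : forall k (f : 'B(X, F)) (i : 'I_(n k)) (x : X),
     T k f (l k i x) = q k i x + s k i x *: f x) :
  let ball_I := closed_ball_ Num.norm (0 : 'B(X, F)) (M / (1 - sbar)) in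
  exists! psi : 'B(X, F), ball_I psi /\
    forall f0 : 'B(X, F), ball_I f0 -> backward T k f0 @[k --> \oo] --> psi.
Proof.
move=> ball_I.
have ballE f : ball_I f = (`|f| <= M / (1 - sbar)).
  by rewrite /ball_I /closed_ball_ /= sub0r normrN.
have s_le : forall k i, `|s k i| <= sbar.
  by apply: le_ereal_sup_bigmax; rewrite s_sup.
have q_le := le_ereal_sup_bigmax q_sup.
have sbar_ge0 : 0 <= sbar by exact: le_trans (s_le 0 (Ordinal (n_gt0 0))).
have l_onto k y : exists i x, y = l k i x.
  have : [set: X] y by [].
  by rewrite (l_cover k) => -[i _ [x _ <-]]; exists i, x.
have r_gt0 : 0 < M / (1 - sbar) by rewrite divr_gt0// subr_gt0.
have ball0 : ball_I 0 by rewrite ballE normr0 ltW.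
have T_ball k f : ball_I f -> ball_I (T k f).
  rewrite !ballE => fr.
  apply: le_trans
    (weighted_pullback_norm (l_onto k) (T_def k) sbar_ge0 (s_le k) f
       (ltW M_gt0) (q_le k)) _.
  (* the radius is the fixed point of r |-> M + sbar * r *)
  have -> : M / (1 - sbar) = M + sbar * (M / (1 - sbar)).
    by field; rewrite subr_eq0 gt_eqF.
  by rewrite lerD2l ler_wpM2l.
have T_contr k := weighted_pullback_dist (l_onto k) (T_def k) sbar_ge0 (s_le k).
have ball_diam f g : ball_I f -> ball_I g ->
    `|f - g| <= M / (1 - sbar) + M / (1 - sbar).
  by rewrite !ballE => fr gr; rewrite (le_trans (ler_normB _ _))// lerD.
have ball_closed : closed ball_I by exact: closed_closed_ball_.
have sbar01 : 0 <= sbar < 1 by rewrite sbar_ge0.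
have [psi psi_ball psi_cvg] := backward_cvg (ex_intro _ 0 ball0) ball_closed
  ball_diam sbar01 T_ball T_contr.
exists psi; split=> // phi [_ phi_cvg].
apply: (cvg_unique _ (psi_cvg 0 ball0) (phi_cvg 0 ball0)).
exact: norm_hausdorff.
Qed.
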